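(* Let $f:\mathbb{R}^N\to\mathbb{R}$ be a smooth function with zero set $Z(f)=\{x\in\mathbb{R}^N: f(x)=0\}$. Assume $Z(f)\subset[-M_1,M_1]^N$, and $|\nabla f|_{2}\le M_2$ and $|\operatorname{Hess} f|_2\le M_3$ on $[-M_1,M_1]^N$. If $Z(f)$ is non-singular, then the subdivision algorithm described in the context, run with input $f,M_1,M_2,M_3$, terminates after finitely many steps, and it yields a set $B\subset\mathbb{R}^N$ (the union of all boxes in CaseTwoBoxes) with $Z(f)\subset B$ such that $$|\nabla f(x)|_1> M_3N^{3/2}\frac{\epsilon}{2}\quad\text{for all }x\in B$$ and $$|f(x)|>\sqrt{N}\,\frac{\epsilon}{2}M_2\quad\text{for all }x\in[-M_1,M_1]^N\setminus B,$$ where $\epsilon$ is the side length of the smallest box in CaseOneBoxes $\cup$ CaseTwoBoxes.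
   Context: Notation. $|\cdot|_2=|\cdot|_{\mathbb{R}^N}$ is the Euclidean norm of a vector; $|v|_1=|v_1|+\dots+|v_N|$ for $v\in\mathbb{R}^N$; for a matrix $A$, $|A|_2=\max_{x\ne0}|Ax|_{\mathbb{R}^N}/|x|_{\mathbb{R}^N}$. $Z(f)$ is non-singular if $\nabla f(x)\neq0$ for every $x\in Z(f)$. Algorithm. Boxes are closed axis-parallel cubes in $\mathbb{R}^N$. For a box $b$, subdivide$(b)$ is the set of $2^N$ boxes of half the side length whose union is $b$. Initialise NewBoxes $=\{[-M_1,M_1]^N\}$, CaseOneBoxes $=\emptyset$, CaseTwoBoxes $=\emptyset$. While NewBoxes $\ne\emptyset$: remove a box $b$ from NewBoxes; let $m$ be its midpoint and $\varepsilon$ its side length; - if $|f(m)|>\sqrt N\,\varepsilon M_2$, add $b$ to CaseOneBoxes; - else if $|\nabla f(m)|_1>N^{3/2}\varepsilon M_3$, add $b$ to CaseTwoBoxes; - else add all boxes of subdivide$(b)$ to NewBoxes. The algorithm terminates when NewBoxes $=\emptyset$. *)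

(* Defs.v *)
From HB Require Import structures.
From mathcomp Require Import all_boot all_order all_algebra.
From mathcomp Require Import all_classical all_reals all_analysis.

Set Implicit Arguments.
Unset Strict Implicit.
Unset Printing Implicit Defensive.

Import Order.TTheory GRing.Theory Num.Theory.
Import numFieldNormedType.Exports.

Local Open Scope classical_set_scope.
Local Open Scope ring_scope.

(* Points of R^N are row vectors.  The norm that MathComp-Analysis puts on
   'rV[R]_N is the sup norm, so the Euclidean and l^1 norms are defined here;
   differentiability does not depend on this choice. *)

Definition l1norm (R : realType) (N : nat) (v : 'rV[R]_N) : R :=
  \sum_(i < N) `|v 0 i|.

Definition l2norm (R : realType) (N : nat) (v : 'rV[R]_N) : R :=
  Num.sqrt (\sum_(i < N) v 0 i ^+ 2).

(* The supremum is a maximum when 0 < N; it is 0 when N = 0. *)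
Definition opnorm (R : realType) (N : nat) (A : 'M[R]_N) : R :=
  sup [set l2norm (A *m x^T)^T / l2norm x | x in [set x : 'rV[R]_N | x != 0]].

Definition pderiv (R : realType) (N : nat) (i : 'I_N) (f : 'rV[R]_N -> R) :
    'rV[R]_N -> R :=
  fun x => 'D_(delta_mx 0 i) f x.

(* Infinitely differentiable: f and all its iterated partial derivatives are
   (Frechet) differentiable at every point. *)
Definition smooth (R : realType) (N : nat) (f : 'rV[R]_N -> R) : Prop :=
  forall (s : seq 'I_N) (x : 'rV[R]_N),
    differentiable (foldr (@pderiv R N) f s) x.

Definition grad (R : realType) (N : nat) (f : 'rV[R]_N -> R) (x : 'rV[R]_N) :
    'rV[R]_N :=
  \row_(i < N) pderiv i f x.

Definition hess (R : realType) (N : nat) (f : 'rV[R]_N -> R) (x : 'rV[R]_N) :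
    'M[R]_N :=
  \matrix_(i < N, j < N) pderiv i (pderiv j f) x.

Definition zero_set (R : realType) (N : nat) (f : 'rV[R]_N -> R) :
    set 'rV[R]_N :=
  [set x | f x = 0].

Definition nonsingular (R : realType) (N : nat) (f : 'rV[R]_N -> R) : Prop :=
  forall x, zero_set f x -> grad f x != 0.

Definition cube (R : realType) (N : nat) (M : R) : set 'rV[R]_N :=
  [set x | forall i, - M <= x 0 i <= M].

Record box (R : realType) (N : nat) := Box {
  midpoint : 'rV[R]_N;
  side : R
}.

Definition box_set (R : realType) (N : nat) (b : box R N) : set 'rV[R]_N :=
  [set x | forall i, `|x 0 i - midpoint b 0 i| <= side b / 2].

(* The sign pattern s selects one of the 2^N orthants around the midpoint;
   the half-size box lying in it has its own midpoint at distance side b / 4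
   in each coordinate. *)
Definition subbox (R : realType) (N : nat) (b : box R N)
    (s : {ffun 'I_N -> bool}) : box R N :=
  Box (\row_(i < N) (midpoint b 0 i + (-1) ^+ s i * (side b / 4)))
      (side b / 2).

Definition subdivide (R : realType) (N : nat) (b : box R N) : set (box R N) :=
  range (subbox b).

Record state (R : realType) (N : nat) := State {
  new_boxes : set (box R N);
  case_one_boxes : set (box R N);
  case_two_boxes : set (box R N)
}.

Definition init_state (R : realType) (N : nat) (M1 : R) : state R N :=
  State [set Box 0 (2 * M1)] set0 set0.

Definition process (R : realType) (N : nat) (f : 'rV[R]_N -> R) (M2 M3 : R)
    (b : box R N) (st : state R N) : state R N :=
  let m := midpoint b in
  let eps := side b in
  let rest := new_boxes st `\` [set b] in
  if `|f m| > Num.sqrt N%:R * eps * M2 then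
    State rest (case_one_boxes st `|` [set b]) (case_two_boxes st)
  else if l1norm (grad f m) > N%:R `^ (3 / 2) * eps * M3 then
    State rest (case_one_boxes st) (case_two_boxes st `|` [set b])
  else
    State (rest `|` subdivide b) (case_one_boxes st) (case_two_boxes st).

(* The box to be processed is chosen arbitrarily, so the loop is a relation;
   a state without new boxes is final, and the run then stays there. *)
Definition loop_step (R : realType) (N : nat) (f : 'rV[R]_N -> R) (M2 M3 : R)
    (st st' : state R N) : Prop :=
  (new_boxes st = set0 /\ st' = st) \/
  (exists2 b, new_boxes st b & st' = process f M2 M3 b st).

Definition execution (R : realType) (N : nat) (f : 'rV[R]_N -> R)
    (M1 M2 M3 : R) (run : nat -> state R N) : Prop :=
  run 0%N = init_state N M1 /\
  forall n, loop_step f M2 M3 (run n) (run n.+1).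

Lemma execution_exists (R : realType) (N : nat) (f : 'rV[R]_N -> R)
    (M1 M2 M3 : R) : exists run, execution f M1 M2 M3 run.
Proof.
have /choice[next nextP] : forall st : state R N,
    exists st', loop_step f M2 M3 st st'.
  move=> st; have [new0|/set0P[b newb]] := eqVneq (new_boxes st) set0.
    by exists st; left.
  by exists (process f M2 M3 b st); right; exists b.
by exists (fun n => iter n next (init_state N M1)); split=> // n; exact: nextP.
Qed.

Definition smallest_side (R : realType) (N : nat) (bs : set (box R N))
    (eps : R) : Prop :=
  (exists2 b, bs b & side b = eps) /\ (forall b, bs b -> eps <= side b).

(* Main.v *)
Require Import Defs.
From mathcomp Require Import all_boot all_order all_algebra.
From mathcomp Require Import all_classical all_reals all_analysis.
From mathcomp Require Import ring lra.

Set Implicit Arguments.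
Unset Strict Implicit.

Import Order.TTheory GRing.Theory Num.Theory.
Import numFieldNormedType.Exports.

Local Open Scope classical_set_scope.
Local Open Scope ring_scope.

(** Termination is a compactness argument. Since [Z(f)] is non-singular, [|f| +
    |grad f|_1] is continuous and positive on the cube, so it has a positive
    lower bound [c] there ([value_gradient_bound]). At the midpoint of a box
    that fails both tests, this quantity is at most a constant times the side;
    hence small boxes pass one of the tests and the bisection depth is bounded
    ([small_box_passes]). Whatever the order in which the boxes are chosen, a
    weight on the pending boxes that makes a box heavier than all its children
    together then decreases strictly at each iteration
    ([execution_terminates]).

    Correctness is the mean value inequality. Each point of a box is within
    [sqrt N * side / 2] of its midpoint in the Euclidean norm. The bound [M2]
    on the gradient makes [f] an [M2]-Lipschitz function on the cube, so the
    value inequality at the midpoint holds on the whole box with half its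
    threshold ([case_one_value_bound]). The gradient of the [j]-th partial
    derivative is the [j]-th column of the Hessian, whose norm is at most the
    operator norm; each partial derivative is thus [M3]-Lipschitz, and summing
    over [j] costs a factor [N], which gives the exponent [3/2] of the gradient
    test ([case_two_gradient_bound]). At every stage the pending and the
    classified boxes cover the initial cube ([valid_execution]), so at the end
    each point of the cube lies in a classified box, of side at least [eps]. A
    zero of [f] cannot lie outside [B], where [|f|] is positive. *)

(** * Euclidean and operator norms *)

Lemma cauchy_schwarz_sum (R : realFieldType) (I : finType) (a b : I -> R) :
  (\sum_i a i * b i) ^+ 2 <= (\sum_i a i ^+ 2) * (\sum_i b i ^+ 2).
Proof.
(* Lagrange's identity: the defect is a sum of squares. *)
have lagrange : (\sum_i a i ^+ 2) * (\sum_i b i ^+ 2) *+ 2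
    - (\sum_i a i * b i) ^+ 2 *+ 2
    = \sum_i \sum_j (a i * b j - a j * b i) ^+ 2.
  rewrite expr2 !mulr2n {2}[(\sum_i a i ^+ 2) * _]mulrC !big_distrlr /=.
  rewrite -!big_split -sumrB; apply: eq_bigr => i _ /=.
  rewrite -!big_split -sumrB; apply: eq_bigr => j _ /=; ring.
have : 0 <= \sum_i \sum_j (a i * b j - a j * b i) ^+ 2.
  by do 2 (apply: sumr_ge0 => ? _); exact: sqr_ge0.
by rewrite -lagrange -mulrnBl pmulrn_lge0 // subr_ge0.
Qed.

Lemma dot_le_l2norm (R : realType) (N : nat) (u v : 'rV[R]_N) :
  `|\sum_i u 0 i * v 0 i| <= l2norm u * l2norm v.
Proof.
rewrite -sqrtr_sqr -sqrtrM ?sumr_ge0 // => [|i _]; last exact: sqr_ge0.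
by rewrite ler_wsqrtr // cauchy_schwarz_sum.
Qed.

Lemma l2norm_ge0 (R : realType) (N : nat) (v : 'rV[R]_N) : 0 <= l2norm v.
Proof. exact: sqrtr_ge0. Qed.

Lemma l2norm_le_sup (R : realType) (N : nat) (v : 'rV[R]_N) (r : R) :
  0 <= r -> (forall i, `|v 0 i| <= r) -> l2norm v <= Num.sqrt N%:R * r.
Proof.
move=> r0 vr; rewrite -[X in _ * X]ger0_norm // -sqrtr_sqr -sqrtrM //.
apply: ler_wsqrtr; rewrite mulr_natl -[X in _ *+ X]card_ord -sumr_const.
by apply: ler_sum => i _; rewrite -[leLHS]real_normK ?num_real //
  lerXn2r ?nnegrE.
Qed.

Lemma l2norm_gt0 (R : realType) (N : nat) (v : 'rV[R]_N) :
  v != 0 -> 0 < l2norm v.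
Proof.
move=> v0; rewrite lt_def l2norm_ge0 andbT; apply: contra v0.
rewrite sqrtr_eq0 => sum_le0.
have /eqP : \sum_i v 0 i ^+ 2 == 0.
  by rewrite eq_le sum_le0 sumr_ge0 // => i _; exact: sqr_ge0.
move/psumr_eq0P => sq0; apply/eqP/rowP => i; rewrite mxE.
by apply/eqP; rewrite -sqrf_eq0; apply/eqP/sq0 => // j _; exact: sqr_ge0.
Qed.

Lemma l2norm_delta (R : realType) (N : nat) (j : 'I_N) :
  l2norm (delta_mx 0 j : 'rV[R]_N) = 1.
Proof.
rewrite /l2norm (bigD1 j) //= big1 => [|i ij]; rewrite mxE !eqxx /=.
  by rewrite addr0 expr1n sqrtr1.
by rewrite (negbTE ij) expr0n.
Qed.

(** The Frobenius norm is an upper bound, by Cauchy-Schwarz on each row.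
    Without boundedness the supremum defining [opnorm] would carry no
    information. *)
Lemma has_ubound_opnorm (R : realType) (N : nat) (A : 'M[R]_N) :
  has_ubound [set l2norm (A *m x^T)^T / l2norm x
             | x in [set x : 'rV[R]_N | x != 0]].
Proof.
exists (Num.sqrt (\sum_i \sum_j A i j ^+ 2)) => _ [x /= x0 <-].
have rows_ge0 : 0 <= \sum_i \sum_j A i j ^+ 2.
  by do 2 (apply: sumr_ge0 => ? _); exact: sqr_ge0.
rewrite ler_pdivrMr ?l2norm_gt0 // -sqrtrM // ler_wsqrtr //.
rewrite big_distrl; apply: ler_sum => i _; rewrite !mxE.
rewrite (eq_bigr (fun j => A i j * x 0 j)) => [|j _]; last by rewrite mxE.
exact: cauchy_schwarz_sum.
Qed.

Lemma opnorm_ge0 (R : realType) (N : nat) (A : 'M[R]_N) : 0 <= opnorm A.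
Proof.
rewrite /opnorm; have := has_ubound_opnorm A; set E := [set _ | _ in _] => ubE.
have [->|/set0P[y Ey]] := eqVneq E set0; first by rewrite sup0.
apply: (@le_trans _ _ y); last exact: (ub_le_sup ubE).
by case: Ey => x _ <-; rewrite divr_ge0 ?l2norm_ge0.
Qed.

(** A column is the image of a unit vector. *)
Lemma col_le_opnorm (R : realType) (N : nat) (A : 'M[R]_N) (j : 'I_N) :
  l2norm (col j A)^T <= opnorm A.
Proof.
apply: (ub_le_sup (has_ubound_opnorm _)); exists (delta_mx 0 j) => /=.
  by apply/eqP => /(congr1 (@l2norm _ _)); rewrite l2norm_delta => /eqP;
     rewrite /l2norm big1 ?sqrtr0 ?oner_eq0// => i _; rewrite mxE expr0n.
by rewrite l2norm_delta divr1 trmx_delta colE.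
Qed.

(** * The mean value inequality on the cube *)

Lemma derive_grad (R : realType) (N : nat) (g : 'rV[R]_N -> R)
    (x v : 'rV[R]_N) :
  differentiable g x -> 'D_v g x = \sum_i grad g x 0 i * v 0 i.
Proof.
move=> dg; rewrite deriveE // {1}(row_sum_delta v) linear_sum.
by apply: eq_bigr => i _; rewrite linearZ /= mxE /pderiv deriveE // mulrC.
Qed.

(** The cube is convex, so the one-variable mean value theorem applies along the
    segment from [y] to [x], on which the gradient bound holds. *)
Lemma mvt_cube (R : realType) (N : nat) (g : 'rV[R]_N -> R) (M1 M : R) :
  (forall x, differentiable g x) ->
  (forall x, cube M1 x -> l2norm (grad g x) <= M) ->
  forall x y, cube M1 x -> cube M1 y ->
  `|g x - g y| <= M * l2norm (x - y).
Proof.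
move=> dg gM x y cx cy; pose h t := g (y + t *: (x - y)).
have dh (t : R) : is_derive t 1 h ('D_(x - y) g (y + t *: (x - y))).
  (* Difference quotients of [h] are those of [g] in direction [x - y]. *)
  have slopeE : (fun s : R => s^-1 *: (h (s *: 1 + t) - h t)) =
      (fun s => s^-1 *: (g (s *: (x - y) + (y + t *: (x - y)))
                         - g (y + t *: (x - y)))).
    apply/funext => s; congr (_ *: (g _ - _)).
    by rewrite [s *: 1]mulr1 scalerDl addrCA.
  apply: DeriveDef; last by rewrite /derive /= slopeE.
  rewrite /derivable /= slopeE.
  exact: diff_derivable.
have ch : {within `[0, 1], continuous h}.
  by apply: derivable_within_continuous => t _; apply: ex_derive.
have [|t t01] := MVT_segment _ (fun t _ => dh t) ch; first exact: ler01.
rewrite /h scale0r addr0 scale1r subr0 mulr1 [y + _]addrC subrK => ->.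
rewrite derive_grad //; apply: le_trans (dot_le_l2norm _ _) _.
apply: ler_wpM2r; first exact: l2norm_ge0.
apply: gM => i; rewrite !mxE.
have := cx i; have := cy i; move: t01; rewrite in_itv /=.
nra.
Qed.

(** * From the midpoint of a box to the whole box *)

Definition case_one_test (R : realType) (N : nat) (f : 'rV[R]_N -> R) (M2 : R)
    (b : box R N) : bool :=
  Num.sqrt N%:R * side b * M2 < `|f (midpoint b)|.

Definition case_two_test (R : realType) (N : nat) (f : 'rV[R]_N -> R) (M3 : R)
    (b : box R N) : bool :=
  N%:R `^ (3 / 2) * side b * M3 < l1norm (grad f (midpoint b)).

Lemma powR_three_halves (R : realType) (x : R) :
  0 <= x -> x `^ (3 / 2) = x * Num.sqrt x.
Proof.
move=> x0; rewrite powRrM powR_mulrn // powR12_sqrt ?exprn_ge0 //.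
by rewrite exprSr sqrtrM ?sqr_ge0 // sqrtr_sqr ger0_norm.
Qed.

Lemma l2norm_sub_midpoint (R : realType) (N : nat) (b : box R N)
    (x : 'rV[R]_N) :
  0 <= side b -> box_set b x ->
  l2norm (midpoint b - x) <= Num.sqrt N%:R * (side b / 2).
Proof.
move=> sb bx; apply: l2norm_le_sup; first by rewrite divr_ge0.
by move=> i; rewrite !mxE distrC; exact: bx.
Qed.

Lemma box_set_midpoint (R : realType) (N : nat) (b : box R N) :
  0 <= side b -> box_set b (midpoint b).
Proof. by move=> sb i; rewrite subrr normr0 divr_ge0. Qed.

(** Moving from the midpoint to [x] changes [f] by at most half of the
    threshold of the test. *)
Lemma case_one_value_bound (R : realType) (N : nat) (f : 'rV[R]_N -> R)
    (M1 M2 : R) (b : box R N) (x : 'rV[R]_N) :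
  (forall x, differentiable f x) ->
  (forall x, cube M1 x -> l2norm (grad f x) <= M2) ->
  0 <= side b -> box_set b `<=` cube M1 -> case_one_test f M2 b ->
  box_set b x -> Num.sqrt N%:R * (side b / 2) * M2 < `|f x|.
Proof.
move=> df gradM sb sub_cube test bx.
have cx := sub_cube _ bx; have cm := sub_cube _ (box_set_midpoint sb).
have M2_ge0 : 0 <= M2 := le_trans (l2norm_ge0 _) (gradM x cx).
have := mvt_cube df gradM cm cx.
have : M2 * l2norm (midpoint b - x) <= M2 * (Num.sqrt N%:R * (side b / 2)).
  by apply: ler_wpM2l => //; exact: l2norm_sub_midpoint.
have := lerB_dist (f (midpoint b)) (f x).
move: test; rewrite /case_one_test; lra.
Qed.

(** This brings the mean value inequality for [pderiv j f] under the bound on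
    the Hessian. *)
Lemma grad_pderiv_hess (R : realType) (N : nat) (f : 'rV[R]_N -> R) (j : 'I_N)
    (x : 'rV[R]_N) : grad (pderiv j f) x = (col j (hess f x))^T.
Proof. by apply/rowP => i; rewrite !mxE. Qed.

(** Each partial derivative moves by at most [sqrt N * side b / 2 * M3]; the [N]
    of them together move by half of the threshold of the test. *)
Lemma case_two_gradient_bound (R : realType) (N : nat) (f : 'rV[R]_N -> R)
    (M1 M3 : R) (b : box R N) (x : 'rV[R]_N) :
  smooth f ->
  (forall x, cube M1 x -> opnorm (hess f x) <= M3) ->
  0 <= side b -> box_set b `<=` cube M1 -> case_two_test f M3 b ->
  box_set b x -> N%:R `^ (3 / 2) * (side b / 2) * M3 < l1norm (grad f x).
Proof.
move=> sf hessM sb sub_cube test bx.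
have cx := sub_cube _ bx; have cm := sub_cube _ (box_set_midpoint sb).
have M3_ge0 : 0 <= M3 := le_trans (opnorm_ge0 _) (hessM x cx).
have pderiv_close j : `|pderiv j f (midpoint b)| - `|pderiv j f x|
    <= M3 * (Num.sqrt N%:R * (side b / 2)).
  apply: le_trans (lerB_dist _ _) _.
  have dj : forall y, differentiable (pderiv j f) y := sf [:: j].
  apply: le_trans (mvt_cube (M1 := M1) (M := M3) dj _ cm cx) _.
    move=> y cy; rewrite grad_pderiv_hess.
    exact: le_trans (col_le_opnorm _ _) (hessM y cy).
  by apply: ler_wpM2l => //; exact: l2norm_sub_midpoint.
have : l1norm (grad f (midpoint b)) - l1norm (grad f x)
    <= M3 * (Num.sqrt N%:R * (side b / 2)) *+ N.
  rewrite -sumrB -[X in _ *+ X]card_ord -sumr_const.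
  by apply: ler_sum => j _; rewrite !mxE.
move: test; rewrite /case_two_test powR_three_halves // -mulr_natl; lra.
Qed.

(** * Dyadic boxes *)

(** A word of sign patterns, read from left to right, is the path from the
    initial cube to the box.  Words record the depth of a box even when
    [M1 = 0], where all these boxes coincide. *)
Definition dyadic_box (R : realType) (N : nat) (M1 : R)
    (w : seq {ffun 'I_N -> bool}) : box R N :=
  foldl (@subbox R N) (Box 0 (2 * M1)) w.

Lemma dyadic_box_rcons (R : realType) (N : nat) (M1 : R)
    (w : seq {ffun 'I_N -> bool}) (s : {ffun 'I_N -> bool}) :
  dyadic_box M1 (rcons w s) = subbox (dyadic_box M1 w) s.
Proof. by rewrite /dyadic_box foldl_rcons. Qed.

Lemma side_dyadic_box (R : realType) (N : nat) (M1 : R)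
    (w : seq {ffun 'I_N -> bool}) :
  side (dyadic_box M1 w) = 2 * M1 / 2 ^+ size w.
Proof.
elim/last_ind: w => [|w s IHw]; first by rewrite divr1.
by rewrite dyadic_box_rcons size_rcons /= IHw exprSr invfM mulrA mulrAC.
Qed.

Lemma side_dyadic_box_ge0 (R : realType) (N : nat) (M1 : R)
    (w : seq {ffun 'I_N -> bool}) :
  0 <= M1 -> 0 <= side (dyadic_box M1 w).
Proof.
by move=> M10; rewrite side_dyadic_box divr_ge0 ?mulr_ge0 ?exprn_ge0.
Qed.

Lemma box_set_init (R : realType) (N : nat) (M1 : R) :
  box_set (Box (0 : 'rV[R]_N) (2 * M1)) = cube M1.
Proof.
apply/seteqP; split=> x bx i; have := bx i => /=; rewrite !mxE subr0 ler_norml;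
  by have -> : 2 * M1 / 2 = M1 by lra.
Qed.

Lemma box_set_subbox (R : realType) (N : nat) (b : box R N)
    (s : {ffun 'I_N -> bool}) :
  box_set (subbox b s) `<=` box_set b.
Proof.
move=> x bx i; have := bx i; rewrite /= !mxE !ler_norml.
by case: (s i) => /=; rewrite ?expr1 ?expr0 => /andP[? ?];
  apply/andP; split; lra.
Qed.

Lemma box_set_dyadic_box (R : realType) (N : nat) (M1 : R)
    (w : seq {ffun 'I_N -> bool}) : box_set (dyadic_box M1 w) `<=` cube M1.
Proof.
elim/last_ind: w => [|w s IHw]; first by rewrite /dyadic_box /= box_set_init.
rewrite dyadic_box_rcons.
exact: subset_trans (@box_set_subbox _ _ _ s) IHw.
Qed.

Lemma subdivide_cover (R : realType) (N : nat) (b : box R N) (x : 'rV[R]_N) :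
  box_set b x -> exists2 b', subdivide b b' & box_set b' x.
Proof.
move=> bx; pose s := [ffun i => x 0 i < midpoint b 0 i].
exists (subbox b s); first by exists s.
move=> i; have := bx i; rewrite /= !mxE ffunE !ler_norml => /andP[? ?].
by case: ltP => ?; rewrite ?expr1 ?expr0; apply/andP; split; lra.
Qed.

(** * Boundedness of the subdivision depth *)

Lemma compact_cube (R : realType) (N : nat) (M1 : R) :
  compact (cube M1 : set 'rV[R]_N).
Proof.
have := @rV_compact R N (fun=> `[- M1, M1]%classic)
  (fun=> @segment_compact _ _ _).
congr (compact _); apply/seteqP; split=> x xM i; have := xM i;
  by rewrite /= in_itv.
Qed.

(** The sum is continuous, and it vanishes only at a singular zero of [f]; its
    minimum on the compact cube is therefore positive. *)
Lemma value_gradient_bound (R : realType) (N : nat) (f : 'rV[R]_N -> R)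
    (M1 : R) :
  0 <= M1 -> smooth f -> nonsingular f ->
  exists2 c, 0 < c & forall x, cube M1 x -> c <= `|f x| + l1norm (grad f x).
Proof.
move=> M1_ge0 sf nsf; pose F (x : 'rV[R]_N) : R :=
  `|f x| + l1norm (grad f x).
have contF : continuous F.
  have norm_cont (g : 'rV[R]_N -> R) :
      (forall x, differentiable g x) -> continuous (fun x => `|g x|).
    move=> dg x; apply: (@continuous_comp _ _ _ g (fun y : R => `|y|)).
      exact: differentiable_continuous.
    exact: norm_continuous.
  have FE : F = (fun x => `|f x|) \+ (fun x => \sum_i `|pderiv i f x|).
    by apply/funext => x; congr (_ + _); apply: eq_bigr => i _; rewrite mxE.
  have sum_cont : continuous (fun x => \sum_i `|pderiv i f x|).
    apply: (continuous_big (@add_continuous R^o)) => i _.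
    exact: norm_cont (sf [:: i]).
  rewrite FE => x; apply: continuousD; last exact: sum_cont.
  exact: norm_cont (sf [::]) x.
have cube0 : (cube M1 : set 'rV[R]_N) !=set0.
  by exists 0 => i; rewrite mxE oppr_le0 M1_ge0.
have [c _ Fc] := EVT_min_rV cube0 (@compact_cube _ _ _)
  (continuous_subspaceT contF).
exists (F c); last by move=> x cx; apply: Fc; rewrite inE.
have l1_ge0 : 0 <= l1norm (grad f c) by apply: sumr_ge0.
have [fc0|fc0] := eqVneq (f c) 0; last by rewrite ltr_pwDl ?normr_gt0.
rewrite ltr_wpDl // lt_def l1_ge0 andbT.
apply: contra (nsf c fc0) => /eqP/psumr_eq0P l1_0.
by apply/eqP/rowP => i; rewrite [RHS]mxE; apply/eqP; rewrite -normr_eq0 l1_0.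
Qed.

(** If both tests fail, adding the two failed inequalities at the midpoint
    gives [c <= C / 2 ^ size w], which is false at large depth. *)
Lemma small_box_passes (R : realType) (N : nat) (f : 'rV[R]_N -> R)
    (M1 M2 M3 : R) :
  0 <= M1 -> smooth f -> nonsingular f ->
  exists D, forall w : seq {ffun 'I_N -> bool}, (D <= size w)%N ->
    case_one_test f M2 (dyadic_box M1 w)
    || case_two_test f M3 (dyadic_box M1 w).
Proof.
move=> M1_ge0 sf nsf.
have [c c0 cF] := value_gradient_bound M1_ge0 sf nsf.
pose C := (Num.sqrt N%:R * M2 + N%:R `^ (3 / 2) * M3) * (2 * M1).
exists (Num.Def.archi_bound (C / c)) => w Dw.
have : C / 2 ^+ size w < c.
  rewrite ltr_pdivrMr ?exprn_gt0 // mulrC -ltr_pdivrMr //.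
  exact: upper_nthrootP Dw.
have -> : C / 2 ^+ size w =
    Num.sqrt N%:R * side (dyadic_box M1 w) * M2
    + N%:R `^ (3 / 2) * side (dyadic_box M1 w) * M3.
  by rewrite side_dyadic_box /C; ring.
have := cF _ (box_set_dyadic_box
  (box_set_midpoint (side_dyadic_box_ge0 w M1_ge0))).
rewrite /case_one_test /case_two_test.
case: ltP => //= ?; case: ltP => //= ?; lra.
Qed.

(** * Termination *)

(** A box of depth less than [D] is worth more than its [2 ^ N] children
    together, and every box is worth at least 1. The pending boxes are listed
    by words because the loop stores them as a mere set. *)
Definition weight (N D : nat) (s : seq (seq {ffun 'I_N -> bool})) : nat :=
  \sum_(w <- s) (2 ^ N).+1 ^ (D - size w).

Lemma weight_cat (N D : nat) (s t : seq (seq {ffun 'I_N -> bool})) :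
  weight D (s ++ t) = (weight D s + weight D t)%N.
Proof. exact: big_cat. Qed.

Lemma weight_filter (N D : nat) (s : seq (seq {ffun 'I_N -> bool}))
    (P : pred (seq {ffun 'I_N -> bool})) (w : seq {ffun 'I_N -> bool}) :
  w \in s -> ~~ P w ->
  (weight D [seq w <- s | P w] + (2 ^ N).+1 ^ (D - size w) <= weight D s)%N.
Proof.
move=> ws Pw; rewrite /weight big_filter [leqRHS](bigID P) /= leq_add2l.
rewrite (perm_big _ (perm_to_rem ws)) big_cons Pw; exact: leq_addr.
Qed.

Lemma weight_children (N D : nat) (w : seq {ffun 'I_N -> bool}) :
  (size w < D)%N ->
  (weight D [seq rcons w t | t : {ffun 'I_N -> bool}]
     < (2 ^ N).+1 ^ (D - size w))%N.
Proof.
move=> wD; rewrite /weight big_map big_enum /=.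
under eq_bigr do rewrite size_rcons.
rewrite sum_nat_const card_ffun card_bool card_ord -(subnSK wD).
by rewrite expnS ltn_pmul2r ?expn_gt0.
Qed.

(** The words only need to cover the pending boxes, which absorbs coincidences
    between boxes: all words naming the processed box are dropped at once, and
    at least one of them is in the list. *)
Lemma loop_step_weight (R : realType) (N : nat) (f : 'rV[R]_N -> R)
    (M1 M2 M3 : R) (D : nat) (st st' : state R N)
    (s : seq (seq {ffun 'I_N -> bool})) :
  (forall w : seq {ffun 'I_N -> bool}, (D <= size w)%N ->
    case_one_test f M2 (dyadic_box M1 w)
    || case_two_test f M3 (dyadic_box M1 w)) ->
  loop_step f M2 M3 st st' -> new_boxes st !=set0 ->
  new_boxes st `<=` dyadic_box M1 @` [set` s] ->
  exists2 s', (weight D s' < weight D s)%N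
            & new_boxes st' `<=` dyadic_box M1 @` [set` s'].
Proof.
move=> passD [[-> _] [? []]|[b newb ->]] _ new_s.
have [w ws wb] := new_s _ newb.
pose keep w' := `[< dyadic_box M1 w' <> b >].
have keepNw : ~~ keep w by rewrite /keep; apply/asboolPn; rewrite wb; exact.
have weight_keep := weight_filter D ws keepNw.
have rest_keep : new_boxes st `\` [set b] `<=`
    dyadic_box M1 @` [set` [seq w <- s | keep w]].
  move=> c [/new_s[w' w's <-] w'b]; exists w' => //=.
  by rewrite mem_filter w's andbT; apply/asboolP.
have done_weight : (weight D [seq w <- s | keep w] < weight D s)%N.
  by apply: leq_trans weight_keep; rewrite -[ltnLHS]addn0 ltn_add2l expn_gt0.
rewrite /process -/(case_one_test f M2 b) -/(case_two_test f M3 b).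
case: ifPn => [_|fail1]; first by exists [seq w <- s | keep w].
case: ifPn => [_|fail2]; first by exists [seq w <- s | keep w].
have wD : (size w < D)%N.
  rewrite ltnNge; apply/negP => /passD.
  by rewrite wb (negbTE fail1) (negbTE fail2).
exists ([seq w <- s | keep w] ++ [seq rcons w t | t : {ffun 'I_N -> bool}]).
  rewrite weight_cat; apply: leq_trans weight_keep.
  by rewrite ltn_add2l weight_children.
move=> c [/rest_keep[w' w's <-]|[t _ <-]].
  by exists w' => //=; rewrite mem_cat w's.
exists (rcons w t); last by rewrite dyadic_box_rcons wb.
by rewrite /= mem_cat map_f ?orbT // mem_enum.
Qed.

Lemma execution_terminates (R : realType) (N : nat) (f : 'rV[R]_N -> R)
    (M1 M2 M3 : R) (D : nat) (run : nat -> state R N) :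
  (forall w : seq {ffun 'I_N -> bool}, (D <= size w)%N ->
    case_one_test f M2 (dyadic_box M1 w)
    || case_two_test f M3 (dyadic_box M1 w)) ->
  execution f M1 M2 M3 run -> exists n, new_boxes (run n) = set0.
Proof.
move=> passD [run0 runS].
suff descent k : forall n s, (weight D s < k)%N ->
    new_boxes (run n) `<=` dyadic_box M1 @` [set` s] ->
    exists m, new_boxes (run m) = set0.
  apply: (descent _ 0%N [:: [::]] (ltnSn _)).
  by rewrite run0 => _ ->; exists [::] => //=; rewrite inE.
elim: k => // k IHk n s sk new_s.
have [new0|/set0P new0] := eqVneq (new_boxes (run n)) set0; first by exists n.
have [s' s's new_s'] := loop_step_weight passD (runS n) new0 new_s.
exact: IHk (leq_trans s's sk) new_s'.
Qed.

(** * Invariants of the loop *)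

Definition all_boxes (R : realType) (N : nat) (st : state R N) :
    set (box R N) :=
  new_boxes st `|` (case_one_boxes st `|` case_two_boxes st).

(** [valid_dyadic] keeps all boxes inside the initial cube, where the derivative
    bounds hold, and their sides nonnegative; [valid_finite] provides a smallest
    classified box. *)
Record valid_state (R : realType) (N : nat) (f : 'rV[R]_N -> R)
    (M1 M2 M3 : R) (st : state R N) : Prop := ValidState {
  valid_cover : cube M1 `<=` \bigcup_(b in all_boxes st) box_set b;
  valid_dyadic : all_boxes st `<=` range (dyadic_box M1);
  valid_case_one : forall b, case_one_boxes st b -> case_one_test f M2 b;
  valid_case_two : forall b, case_two_boxes st b -> case_two_test f M3 b;
  valid_finite : finite_set (case_one_boxes st `|` case_two_boxes st)
}.

Lemma valid_process (R : realType) (N : nat) (f : 'rV[R]_N -> R)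
    (M1 M2 M3 : R) (st : state R N) (b : box R N) :
  new_boxes st b -> valid_state f M1 M2 M3 st ->
  valid_state f M1 M2 M3 (process f M2 M3 b st).
Proof.
move=> newb [cover dyadic one two fin].
rewrite /process -/(case_one_test f M2 b) -/(case_two_test f M3 b).
have [w _ wb] : range (dyadic_box M1) b by apply: dyadic; left.
have dyadic_b c : c = b \/ all_boxes st c -> range (dyadic_box M1) c.
  by move=> [->|/dyadic //]; exists w.
have same_boxes st' : all_boxes st `<=` all_boxes st' ->
    cube M1 `<=` \bigcup_(b in all_boxes st') box_set b.
  by move=> sub x /cover[c cst xc]; exists c => //; exact: sub.
case: ifPn => [pass1|_]; [|case: ifPn => [pass2|_]].
- split => //.
  + apply: same_boxes => c /=; rewrite /all_boxes /=.
    have [->|cb] := pselect (c = b); first by right; left; right.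
    case=> [|[]] ?; [by left|by right; left; left|by right; right].
  + move=> c [[? _]|[[?|->]|?]];
      apply: dyadic_b; rewrite /all_boxes /setU /=; tauto.
  + by move=> c [/one|->].
  + by rewrite setUAC finite_setU; split=> //; exact: finite_set1.
- split => //.
  + apply: same_boxes => c /=; rewrite /all_boxes /=.
    have [->|cb] := pselect (c = b); first by right; right; right.
    case=> [|[]] ?; [by left|by right; left|by right; right; left].
  + move=> c [[? _]|[?|[?|->]]];
      apply: dyadic_b; rewrite /all_boxes /setU /=; tauto.
  + by move=> c [/two|->].
  + by rewrite setUA finite_setU; split=> //; exact: finite_set1.
- split => //.
  + move=> x /cover[c [newc|donec] xc]; last by exists c => //; right.
    have [cb|cb] := pselect (c = b); last by exists c => //; left; left.
    rewrite cb in xc; have [b' bb' xb'] := subdivide_cover xc.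
    by exists b' => //; left; right.
  + move=> c [[[? _]|[t _ <-]]|?];
      [|by exists (rcons w t); rewrite // dyadic_box_rcons wb|];
      apply: dyadic_b; rewrite /all_boxes /setU /=; tauto.
Qed.

Lemma valid_execution (R : realType) (N : nat) (f : 'rV[R]_N -> R)
    (M1 M2 M3 : R) (run : nat -> state R N) (n : nat) :
  execution f M1 M2 M3 run -> valid_state f M1 M2 M3 (run n).
Proof.
move=> [run0 runS]; elim: n => [|n IHn].
  rewrite run0; split => //=.
  - by move=> x cx; exists (Box 0 (2 * M1)); [left|rewrite box_set_init].
  - by move=> _ [->|[]] //; exists [::].
  - by rewrite setU0; exact: finite_set0.
have [[_ ->] //|[b newb ->]] := runS n.
exact: valid_process.
Qed.

(** * The smallest classified box and the final estimates *)

Lemma finite_set_min (R : realType) (T : Type) (g : T -> R) (A : set T) :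
  finite_set A -> A !=set0 ->
  exists2 a, A a & forall b, A b -> g a <= g b.
Proof.
move=> finA [a0 Aa0]; have [s gA] := (finite_seqP _).1 (finite_image g finA).
have min_seq (l : seq R) x : x \in l ->
    exists2 m, m \in l & forall y, y \in l -> m <= y.
  elim: l x => [//|y l IHl] x _; case: l IHl => [_|z l IHl].
    by exists y; rewrite ?inE // => t; rewrite inE => /eqP->.
  have [m ml m_min] := IHl z (mem_head _ _).
  have [ym|my] := leP y m.
    exists y => [|t]; first exact: mem_head.
    by rewrite inE => /orP[/eqP->//|/m_min]; exact: le_trans.
  exists m => [|t]; first by rewrite inE ml orbT.
  by rewrite inE => /orP[/eqP->|/m_min//]; exact: ltW.
have mem_s b : A b -> g b \in s.
  by move=> Ab; have : (g @` A) (g b) by [exists b]; rewrite gA.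
have [m ms m_min] := min_seq s _ (mem_s _ Aa0).
have : (g @` A) m by rewrite gA.
by case=> a Aa gam; exists a => // b Ab; rewrite gam; exact/m_min/mem_s.
Qed.

Unset Implicit Arguments.

Theorem proposition1p1 (R : realType) (N : nat) (f : 'rV[R]_N -> R)
    (M1 M2 M3 : R)
    (M1_ge0 : 0 <= M1)
    (f_smooth : smooth f)
    (Zf_cube : zero_set f `<=` cube M1)
    (grad_le : forall x, cube M1 x -> l2norm (grad f x) <= M2)
    (hess_le : forall x, cube M1 x -> opnorm (hess f x) <= M3)
    (f_nonsingular : nonsingular f)
    (run : nat -> state R N)
    (f_run : execution f M1 M2 M3 run) :
  exists n : nat,
    new_boxes (run n) = set0 /\
    let B : set 'rV[R]_N :=
      \bigcup_(b in case_two_boxes (run n)) box_set b in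
    zero_set f `<=` B /\
    exists eps : R,
      [/\ smallest_side
            (case_one_boxes (run n) `|` case_two_boxes (run n)) eps,
          forall x, B x ->
            l1norm (grad f x) > M3 * N%:R `^ (3 / 2) * (eps / 2)
        & forall x, (cube M1 `\` B) x ->
            `|f x| > Num.sqrt N%:R * (eps / 2) * M2].
Proof.
have df : forall x, differentiable f x := f_smooth [::].
have [D passD] := @small_box_passes _ _ f M1 M2 M3 M1_ge0 f_smooth
  f_nonsingular.
have [n new0] := execution_terminates passD f_run.
exists n; split=> // B.
have [cover dyadic one two fin] := valid_execution n f_run.
set done := case_one_boxes (run n) `|` case_two_boxes (run n).
have all_done : all_boxes (run n) = done by rewrite /all_boxes new0 set0U.
have cube0 : cube M1 (0 : 'rV[R]_N).
  by move=> i; rewrite mxE oppr_le0 M1_ge0.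
have done0 : done !=set0.
  by have [b] := cover _ cube0; rewrite all_done; exists b.
have side_ge0 b : done b -> 0 <= side b.
  by rewrite -all_done => /dyadic[w _ <-]; exact: side_dyadic_box_ge0.
have sub_cube b : done b -> box_set b `<=` cube M1.
  by rewrite -all_done => /dyadic[w _ <-]; exact: box_set_dyadic_box.
have M2_ge0 : 0 <= M2 := le_trans (l2norm_ge0 _) (grad_le 0 cube0).
have M3_ge0 : 0 <= M3 := le_trans (opnorm_ge0 _) (hess_le 0 cube0).
have [a da a_min] := finite_set_min (@side R N) fin done0.
(* A point of the cube outside [B] lies in a case one box. *)
have f_big x : (cube M1 `\` B) x ->
    `|f x| > Num.sqrt N%:R * (side a / 2) * M2.
  move=> [/cover[b]]; rewrite all_done => db bx notB.
  have oneb : case_one_boxes (run n) b.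
    by case: (db) => // twob; case: notB; exists b.
  apply: le_lt_trans (case_one_value_bound df grad_le (side_ge0 b db)
    (sub_cube b db) (one b oneb) bx).
  by rewrite ler_wpM2r // ler_wpM2l ?sqrtr_ge0 // ler_wpM2r // a_min.
split.
  move=> x fx0; have cx := Zf_cube x fx0; apply: contrapT => notB.
  have := f_big x (conj cx notB); rewrite fx0 normr0 ltNge.
  by rewrite !mulr_ge0 ?sqrtr_ge0 ?side_ge0.
exists (side a); split=> //; first by split=> //; exists a.
move=> x [b twob bx]; have db : done b by right.
rewrite -mulrA mulrC.
apply: le_lt_trans (case_two_gradient_bound f_smooth hess_le (side_ge0 b db)
  (sub_cube b db) (two b twob) bx).
by rewrite ler_wpM2r // ler_wpM2l ?powR_ge0 // ler_wpM2r // a_min.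
Qed.
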